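(* Let $F$ and $G$ be finite groups acting transitively on $Y=F/H$ and $X=G/K$, with $H$ the stabilizer of $y_0\in Y$ and $K$ the stabilizer of $x_0\in X$. Let $\mathcal{P}$ be a $G$-invariant partition of $X$ and $\mathcal{Q}$ an $F$-invariant partition of $Y$, and assume that $N=\{u\in F:uB=B\ \text{for all }B\in\mathcal{Q}\}$ is transitive on every $B\in\mathcal{Q}$. Let $L(X)=\bigoplus_{\omega\in\Omega}a_\omega V_\omega$, $L(Y)=\bigoplus_{\delta\in\Delta}b_\delta W_\delta$, $L(A_0)=\bigoplus_{\gamma\in\Gamma}c_\gamma U_\gamma$ be the decompositions into irreducible representations of $G$, $F$ and $T$ respectively, where $A_0$ is the part of $\mathcal{P}$ containing $x_0$ and $T$ is the stabilizer of $A_0$ in $G$, and let $\Delta_0\subseteq\Delta$ be such that $L(\mathcal{Q})=\bigoplus_{\delta\in\Delta_0}b_\delta W_\delta$. Let $\{v_i^\omega\}_{i=1}^{a_\omega}$, $\{w_j^\delta\}_{j=1}^{b_\delta}$, $\{u_h^\gamma\}_{h=1}^{c_\gamma}$ be orthonormal bases of the $K$-invariant vectors in $V_\omega$, of the $H$-invariant vectors in $W_\delta$, and of the $K$-invariant vectors in $U_\gamma$, with corresponding spherical matrix coefficients $\phi^\omega_{i,i'}$, $\psi^\delta_{j,j'}$, $\theta^\gamma_{h,h'}$. Let $R$ be the stabilizer of $(x_0,y_0)$ in the crested product $(N^{\mathcal{P}}\cdot F^{\mathrm{diag}})\ltimes G$. (1) For $\omega\in\Omega$ and $\delta\in\Delta_0$,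 the set $v_i^\omega\otimes w_j^\delta$, $i=1,\dots,a_\omega$, $j=1,\dots,b_\delta$, is an orthonormal basis for the $R$-invariant vectors in the irreducible representation $V_\omega\otimes W_\delta$. Moreover, the corresponding spherical matrix coefficients are $\phi^\omega_{i,i'}(x)\psi^\delta_{j,j'}(y)$, as functions of $(x,y)\in X\times Y$. (2) For $\gamma\in\Gamma$ and $\delta\in\Delta\setminus\Delta_0$, the set $\tilde u_h^\gamma\otimes w_j^\delta$, $h=1,\dots,c_\gamma$, $j=1,\dots,b_\delta$, is an orthonormal basis for the $R$-invariant vectors in the irreducible representation $(\mathrm{Ind}_T^GU_\gamma)\otimes W_\delta$. Moreover, the corresponding spherical matrix coefficients are $\tilde\theta^\gamma_{h,h'}(x)\psi^\delta_{j,j'}(y)$.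
   Context: For a finite set $Z$, $L(Z)$ is the space of complex functions on $Z$ with $\langle f_1,f_2\rangle=\sum_z f_1(z)\overline{f_2(z)}$ and, if a group acts on $Z$, the permutation action; $L(X\times Y)=L(X)\otimes L(Y)$. A decomposition into irreducible representations $\bigoplus_i m_iW_i$ means the $W_i$ are irreducible, pairwise inequivalent, with multiplicities $m_i$; all representations are unitary. $L(\mathcal{Q})$ is the space of functions on $Y$ constant on each part of $\mathcal{Q}$ (the hypothesis on $N$ guarantees that $\Delta_0$ exists). A partition is invariant if the group permutes its parts. Spherical matrix coefficients: $\phi^\omega_{i,i'}(gx_0)=\langle v_i^\omega,gv_{i'}^\omega\rangle$ for $g\in G$ (a function on $X$); $\psi^\delta_{j,j'}(uy_0)=\langle w_j^\delta,uw_{j'}^\delta\rangle$ for $u\in F$ (a function on $Y$); $\theta^\gamma_{h,h'}(tx_0)=\langle u_h^\gamma,tu_{h'}^\gamma\rangle$ for $t\in T$ (a function on $A_0\cong T/K$). In general, for a group acting transitively with stabilizer $R$ of a base point $p_0$, and an orthonormal basis $(e_i)$ of the $R$-invariant vectors of an irreducible representation, the spherical matrix coefficients are the functions $g\mapsto\langle e_i,ge_{i'}\rangle$, viewed as functions of $gp_0$. $\tilde\theta^\gamma_{h,h'}$ is the function on $X$ equal to $\theta^\gamma_{h,h'}$ on $A_0$ and $0$ on $X\setminus A_0$. $\mathrm{Ind}_T^GU_\gamma=\bigoplus_{A\in\mathcal{P}}l_AU_\gamma$, where $l_A\in G$ satisfies $l_AA_0=A$ and $l_{A_0}=1_G$;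 this is an orthogonal sum of isometric copies of $U_\gamma$, and $\tilde u_h^\gamma=l_{A_0}u_h^\gamma$ is the copy of $u_h^\gamma$ in $l_{A_0}U_\gamma$ (thinking of $U_\gamma$ as a subspace of $L(A_0)$, $\tilde u_h^\gamma$ equals $u_h^\gamma$ on $A_0$ and $0$ on $X\setminus A_0$, and $\mathrm{Ind}_T^GU_\gamma\le L(X)$). The wreath product $F\wr G=F^X\ltimes G$ consists of pairs $(f,g)$, $f:X\to F$, $g\in G$, with $(f,g)(f_1,g_1)=(f\cdot gf_1,gg_1)$, $(f\cdot gf_1)(x)=f(x)f_1(g^{-1}x)$, and acts on $X\times Y$ by $(f,g)(x,y)=(gx,f(gx)y)$. $F^{\mathrm{diag}}$ is the group of constant functions $X\to F$, $N^{\mathcal{P}}$ the group of functions $X\to N$ constant on each part of $\mathcal{P}$; the crested product is the subgroup of all $(f,g)\in F\wr G$ with $f\in N^{\mathcal{P}}\cdot F^{\mathrm{diag}}$. The representations $V_\omega\otimes W_\delta$ ($\delta\in\Delta_0$) and $(\mathrm{Ind}_T^GU_\gamma)\otimes W_\delta$ ($\delta\in\Delta\setminus\Delta_0$) of the crested product are those obtained as subspaces of $L(X)\otimes L(Y)=L(X\times Y)$, where they are invariant and irreducible. *)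

(* Defs.v *)
From HB Require Import structures.
From mathcomp Require Import all_boot all_order all_algebra all_fingroup.

Set Implicit Arguments.
Unset Strict Implicit.
Unset Printing Implicit Defensive.

Import Order.TTheory GRing.Theory Num.Theory.
Local Open Scope ring_scope.

(* The complex numbers are an arbitrary [C : numClosedFieldType] (an
   algebraically closed field with conjugation and norm), which covers the
   field of complex numbers [R[i]] over the reals as well as [algC]. *)

(* MathComp actions are right actions, [to z (g * h) = to (to z g) h].  The
   left action [g z] is [to z g^-1]; every left action arises in this way
   from exactly one right action, with the same stabilizers and orbits. *)
Definition lact (gT : finGroupType) (D : {set gT}) (Z : finType)
  (to : action D Z) (g : gT) (z : Z) : Z := to z g^-1%g.

(* The space L(Z) of complex functions on [Z]. *)
Notation fspace C Z := {ffun Z -> C^o}.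

Section FunctionSpace.
Variables (C : numClosedFieldType) (Z : finType).
Definition inner (f1 f2 : fspace C Z) : C := \sum_z f1 z * (f2 z)^*.

Definition orthonormal_basis (I : finType) (e : I -> fspace C Z)
    (M : {vspace fspace C Z}) : Prop :=
  (forall i j, inner (e i) (e j) = (i == j)%:R) /\ <<codom e>>%VS = M.

Definition const_on_parts (Q : {set {set Z}}) : {vspace fspace C Z} :=
  (\bigcap_(B in Q) \bigcap_(z in B) \bigcap_(z' in B)
     lker (linfun (fun f : fspace C Z => f z - f z' : C^o)))%VS.

Lemma const_on_partsP (Q : {set {set Z}}) (f : fspace C Z) :
  f \in const_on_parts Q <->
  (forall B z z', B \in Q -> z \in B -> z' \in B -> f z = f z').
Proof.
have linE z z' : linfun (fun f : fspace C Z => f z - f z' : C^o) f = f z - f z'.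
  pose d (h : fspace C Z) : C^o := h z - h z'.
  have dlin : linear d.
    by move=> k u v; rewrite /d !ffunE scalerBr opprD addrACA.
  pose dL := GRing.isLinear.Build _ _ _ _ d dlin.
  pose dl : {linear fspace C Z -> C^o} := HB.pack d dL.
  by rewrite (lfunE dl).
split=> [/subv_bigcapP fQ B z z' BQ zB z'B | fQ].
  move/subv_bigcapP/(_ z zB)/subv_bigcapP/(_ z' z'B): (fQ B BQ).
  by rewrite -memvE memv_ker linE subr_eq0 => /eqP.
apply/subv_bigcapP => B BQ; apply/subv_bigcapP => z zB.
apply/subv_bigcapP => z' z'B.
by rewrite -memvE memv_ker linE (fQ B z z') ?subrr.
Qed.

End FunctionSpace.

Section PermutationRepresentation.
Variables (C : numClosedFieldType) (gT : finGroupType) (D : {set gT}).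
Variables (Z : finType) (to : action D Z).

Definition perm_rep (g : gT) (f : fspace C Z) : fspace C Z :=
  [ffun z => f (lact to g^-1%g z)].

Fact perm_rep_is_linear g : linear (perm_rep g).
Proof. by move=> k u v; apply/ffunP => z; rewrite !ffunE. Qed.
HB.instance Definition _ g :=
  GRing.isLinear.Build C (fspace C Z) (fspace C Z) _ (perm_rep g)
    (perm_rep_is_linear g).

(* In what follows [E] is the group that acts, a subgroup of [gT] contained
   in the domain [D] of the action. *)
Variable E : {set gT}.

Definition stable (W : {vspace fspace C Z}) : Prop :=
  forall g f, g \in E -> f \in W -> perm_rep g f \in W.

Definition irreducible (W : {vspace fspace C Z}) : Prop :=
  [/\ W != 0%VS, stable W &
      forall M : {vspace fspace C Z}, (M <= W)%VS -> stable M ->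
        M = 0%VS \/ M = W].

Definition invariants (W : {vspace fspace C Z}) : {vspace fspace C Z} :=
  (W :&: \bigcap_(g in E) fixedSpace (linfun (perm_rep g)))%VS.

Lemma invariantsP (W : {vspace fspace C Z}) (f : fspace C Z) :
  f \in invariants W <->
  f \in W /\ (forall g, g \in E -> perm_rep g f = f).
Proof.
rewrite memv_cap; split=> [/andP[fW /subv_bigcapP fE] | [fW fE]].
  by split=> // g /fE; rewrite -memvE => /fixedSpaceP; rewrite lfunE.
rewrite fW; apply/subv_bigcapP => g /fE gf; rewrite -memvE.
by apply/fixedSpaceP; rewrite lfunE.
Qed.

Definition equivalent (W1 W2 : {vspace fspace C Z}) : Prop :=
  exists2 phi : 'End(fspace C Z),
    (lker phi :&: W1)%VS = 0%VS /\ (phi @: W1)%VS = W2 &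
    forall g f, g \in E -> f \in W1 -> phi (perm_rep g f) = perm_rep g (phi f).

(* [M] is a direct sum, over the [i] in [J], of [m i] copies of [W i]; the
   [W i] (for all [i]) are irreducible and pairwise inequivalent. *)
Definition decomposition (M : {vspace fspace C Z}) (I : finType) (J : {set I})
    (m : I -> nat) (W : I -> {vspace fspace C Z}) : Prop :=
  [/\ forall i, irreducible (W i),
      forall i j, i != j -> ~ equivalent (W i) (W j) &
      exists V : I -> nat -> {vspace fspace C Z},
        [/\ forall i k, i \in J -> (k < m i)%N ->
              stable (V i k) /\ equivalent (V i k) (W i),
            directv (\sum_(i in J) \sum_(k < m i) V i k) &
            M = (\sum_(i in J) \sum_(k < m i) V i k)%VS]].

(* The functions [phi i i'] are the spherical matrix coefficients associated
   with the vectors [e i], for the base point [z0]; as [E] is transitive this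
   determines [phi]. *)
Definition spherical_coefficients (z0 : Z) (I : finType)
    (e : I -> fspace C Z) (phi : I -> I -> fspace C Z) : Prop :=
  forall i i' g, g \in E ->
    phi i i' (lact to g z0) = inner (e i) (perm_rep g (e i')).

End PermutationRepresentation.

Section Tensor.
Variables (C : numClosedFieldType) (X Y : finType).

Definition tens (f1 : fspace C X) (f2 : fspace C Y) : fspace C (X * Y)%type :=
  [ffun p => f1 p.1 * f2 p.2].

(* By bilinearity, the span of all [tens v w] with [v] in [V], [w] in [W]. *)
Definition tensv (V : {vspace fspace C X}) (W : {vspace fspace C Y}) :
    {vspace fspace C (X * Y)%type} :=
  <<[seq tens v w | v <- vbasis V, w <- vbasis W]>>%VS.

Lemma mem_tensv (V : {vspace fspace C X}) (W : {vspace fspace C Y}) v w :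
  v \in V -> w \in W -> tens v w \in tensv V W.
Proof.
move=> /coord_vbasis -> /coord_vbasis ->.
set a := coord _; set b := coord _.
have -> : tens (\sum_i a i v *: (vbasis V)`_i) (\sum_j b j w *: (vbasis W)`_j)
        = \sum_i \sum_j
            (a i v * b j w) *: tens (vbasis V)`_i (vbasis W)`_j.
  apply/ffunP => p; rewrite !ffunE !sum_ffunE mulr_suml.
  apply: eq_bigr => i _; rewrite sum_ffunE mulr_sumr; apply: eq_bigr => j _.
  by rewrite !ffunE /= mulrACA.
apply: memv_suml => i _; apply: memv_suml => j _; apply: memvZ.
by apply: memv_span; apply: allpairs_f; apply: mem_nth; rewrite size_tuple.
Qed.

End Tensor.

Section Extension.
Variables (C : numClosedFieldType) (X : finType) (A : {set X}).

Definition ext0 (f : fspace C {x | x \in A}) : fspace C X :=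
  [ffun x => oapp f 0 (insub x)].

Fact ext0_is_linear : linear ext0.
Proof.
move=> k u v; apply/ffunP => x; rewrite !ffunE.
by case: insubP => [z _ _|_] /=; rewrite ?ffunE // scaler0 addr0.
Qed.
HB.instance Definition _ :=
  GRing.isLinear.Build C (fspace C {x | x \in A}) (fspace C X) _ ext0
    ext0_is_linear.

End Extension.

(* The representation of [gT] induced by a subspace [U] of L(A0), where
   [l A] maps [A0] onto [A]. *)
Definition induced (C : numClosedFieldType) (gT : finGroupType) (X : finType)
    (to : {action gT &-> X}) (P : {set {set X}}) (A0 : {set X})
    (l : {set X} -> gT) (U : {vspace fspace C {x | x \in A0}}) :
    {vspace fspace C X} :=
  (\sum_(A in P)
     linfun (perm_rep (C := C) to (l A)) @: (linfun (@ext0 C X A0) @: U))%VS.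

(* Makes the pointwise group [{ffun X -> fT}] a finGroupType. *)
HB.instance Definition _ (X : finType) (fT : finGroupType) :=
  Finite.on {ffun X -> fT}.

(* The group law depends on the action [toX], which is therefore a (phantom)
   parameter of the type. *)
Definition wreath (gT fT : finGroupType) (X : finType)
  (toX : {action gT &-> X}) : Type := ({ffun X -> fT} * gT)%type.

Section WreathProduct.
Variables (gT fT : finGroupType) (X Y : finType).
Variable toX : {action gT &-> X}.

Local Notation wreath := (wreath fT toX).

HB.instance Definition _ := Finite.on wreath.

Definition wreath_mul (u v : wreath) : wreath :=
  ([ffun x => u.1 x * v.1 (lact toX u.2^-1 x)], u.2 * v.2)%g.
Definition wreath_one : wreath := ([ffun=> 1], 1)%g.
Definition wreath_inv (u : wreath) : wreath :=
  ([ffun x => (u.1 (lact toX u.2 x))^-1], u.2^-1)%g.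

Fact wreath_mulA : associative wreath_mul.
Proof.
move=> u v w; congr pair; last by rewrite /= mulgA.
apply/ffunP => x; rewrite !ffunE /= mulgA.
by rewrite /lact !invgK actM.
Qed.
Fact wreath_mul1 : left_id wreath_one wreath_mul.
Proof.
move=> [f g]; congr pair; last by rewrite /= mul1g.
by apply/ffunP => x; rewrite !ffunE /= mul1g /lact !invg1 act1.
Qed.
Fact wreath_mulV : left_inverse wreath_one wreath_inv wreath_mul.
Proof.
move=> [f g]; congr pair; last by rewrite /= mulVg.
by apply/ffunP => x; rewrite !ffunE /= invgK mulVg.
Qed.
HB.instance Definition _ :=
  Finite_isGroup.Build wreath wreath_mulA wreath_mul1 wreath_mulV.

Variable toY : {action fT &-> Y}.

Definition wreath_lact (u : wreath) (p : X * Y) : X * Y :=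
  let gx := lact toX u.2 p.1 in (gx, lact toY (u.1 gx) p.2).

Definition wreath_ract (p : X * Y) (u : wreath) : X * Y :=
  wreath_lact u^-1%g p.

Fact wreath_ract1 : wreath_ract^~ 1%g =1 id.
Proof.
move=> [x y]; rewrite /wreath_ract /wreath_lact invg1 /= ffunE.
by rewrite /lact !invg1 !act1.
Qed.
Fact wreath_ractM p : act_morph wreath_ract p.
Proof.
case: p => x y [f g] [f1 g1]; rewrite /wreath_ract /wreath_lact /=.
rewrite !ffunE /= /lact !invgK -!actM !mulgV ?act1 ?invgK mul1g.
by rewrite mulgK.
Qed.

Definition wreath_action : {action wreath &-> X * Y} :=
  TotalAction wreath_ract1 wreath_ractM.

Lemma lact_wreath u p : lact wreath_action u p = wreath_lact u p.
Proof. by rewrite /lact /= /wreath_ract invgK. Qed.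

(* The kernel N of the action of [fT] on the parts of [Q]. *)
Definition parts_kernel (Q : {set {set Y}}) : {set fT} := 'C(Q | toY^* )%g.

Lemma parts_kernelP (Q : {set {set Y}}) u :
  u \in parts_kernel Q <->
  (forall B, B \in Q -> [set lact toY u y | y in B] = B).
Proof.
rewrite -groupV; split=> [/astabP uQ B /uQ //|uQ].
by apply/astabP => B /uQ.
Qed.

Definition constant_on_parts_in (P : {set {set X}}) (N : {set fT}) :
    {set {ffun X -> fT}} :=
  [set n : {ffun X -> fT} | [forall x, n x \in N] &&
     [forall A in P, forall x in A, forall x' in A, n x == n x']].

Definition diagonal : {set {ffun X -> fT}} := [set [ffun=> c] | c : fT].

(* The product of the two sets is the pointwise one in the group of functions
   from [X] to [fT]. *)
Definition crested (P : {set {set X}}) (Q : {set {set Y}}) : {set wreath} :=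
  [set u : wreath | u.1 \in
     (constant_on_parts_in P (parts_kernel Q) * diagonal)%g].

End WreathProduct.

(* Main.v *)
Require Import Defs.
From HB Require Import structures.
From mathcomp Require Import all_boot all_order all_algebra all_fingroup.

Set Implicit Arguments.
Unset Strict Implicit.
Unset Printing Implicit Defensive.

Import Order.TTheory GRing.Theory Num.Theory.
Local Open Scope ring_scope.

(** Write a function Phi on X x Y through its slices Phi(x, .) and Phi(., y);
    Phi lies in a tensor product of subspaces of L(X) and L(Y) exactly when its slices
    lie in them ([tensvP]).  An element (f, g) of the crested product sends
    the slice at x to f(x) applied to the slice of Phi at g^-1 x
    ([xslice_wreath]), and f(x) = n(x) c with n(x) in N and n constant on the
    parts of P.  Everything depends on how N acts on W_delta.

    Since N is transitive on the parts of Q, L(Q) is the space of N-invariant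
    functions on Y.  By Schur's lemma and the given decompositions, W_delta is
    contained in L(Q) for delta in Delta_0 and meets it in 0 otherwise
    ([irreducible_decomposition_const], [irreducible_cap_eq0]).

    In the first case the factor n(x) is invisible: (f, g) acts on
    V_omega (x) W_delta as g (x) c, so the crested product acts through G x F.
    Irreducibility is that of an outer tensor product
    ([outer_tensor_irreducible]); invariants and matrix coefficients are
    computed factor by factor.

    In the second case no nonzero vector of W_delta is fixed by N.  Let M be
    an invariant subspace of Ind U (x) W_delta and Phi in M nonzero.  With n equal
    to some element of N on one part A and to 1 elsewhere, n Phi - Phi lives
    on A x Y, and a suitable choice makes it nonzero; a translate lives on
    A_0 x Y, hence in U (x) W_delta, where the stabilizer T of A_0 together
    with F acts as on an outer tensor product ([exists_supported]).  Therefore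
    M contains U (x) W_delta and all its translates, which span.  The same
    elements n, now equal to 1 on A_0, belong to R and force an R-invariant
    vector to vanish off A_0 x Y, so that it is a combination of
    tensors of K-invariant vectors of U and H-invariant vectors of W_delta
    ([invariants_fine]).  The
    coefficients are products because (f, g) acts by the single element
    f(g x_0) on the slices over g A_0, while for g A_0 <> A_0 the supports of
    the two vectors are disjoint ([spherical_fine]). *)

(** * Schur's lemma for permutation representations *)

Section Schur.
Variables (C : numClosedFieldType) (gT : finGroupType) (E : {set gT}).

(** Intertwining is only required on [M], since [equivalent] asks no more; the
    two underlying sets may differ, so that slices, which go from L(X x Y) to
    L(Y), are covered. *)
Definition equivariant (D1 D2 : {set gT}) (Z1 Z2 : finType)
    (to1 : action D1 Z1) (to2 : action D2 Z2) (M : {vspace fspace C Z1})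
    (S : 'Hom(fspace C Z1, fspace C Z2)) : Prop :=
  forall g f, g \in E -> f \in M -> S (perm_rep to1 g f) = perm_rep to2 g (S f).

Section TwoActions.
Variables (D1 D2 : {set gT}) (Z1 Z2 : finType).
Variables (to1 : action D1 Z1) (to2 : action D2 Z2).
Implicit Types (S : 'Hom(fspace C Z1, fspace C Z2)) (M : {vspace fspace C Z1}).

Lemma equivariantW M M' S : (M' <= M)%VS ->
  equivariant to1 to2 M S -> equivariant to1 to2 M' S.
Proof. by move=> /subvP sM' eqS g f gE /sM' fM; apply: eqS. Qed.

Lemma stable_limg M S :
  stable to1 E M -> equivariant to1 to2 M S -> stable to2 E (S @: M).
Proof.
move=> stM eqS g f gE /memv_imgP[m mM ->].
by rewrite -eqS //; apply/memv_img/stM.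
Qed.

Lemma stable_preim M S (N : {vspace fspace C Z2}) :
  stable to1 E M -> equivariant to1 to2 M S -> stable to2 E N ->
  stable to1 E (M :&: S @^-1: N).
Proof.
move=> stM eqS stN g f gE; rewrite !memv_cap -!memv_preim => /andP[fM SfN].
by rewrite stM ?eqS //=; apply: stN.
Qed.

Lemma stable_ker M S :
  stable to1 E M -> equivariant to1 to2 M S -> stable to1 E (M :&: lker S).
Proof.
move=> stM eqS g f gE; rewrite !memv_cap !memv_ker => /andP[fM /eqP Sf0].
by rewrite stM ?eqS // Sf0 linear0 eqxx.
Qed.

Lemma schur_inj M S : irreducible to1 E M -> equivariant to1 to2 M S ->
  (S @: M)%VS != 0%VS -> (M :&: lker S)%VS = 0%VS.
Proof.
move=> [_ stM irrM] eqS SM0.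
case: (irrM _ (capvSl M (lker S)) (stable_ker stM eqS)) => // kerM.
by case/negP: SM0; rewrite -lkerE -kerM capvSr.
Qed.

Lemma schur_bij M (N : {vspace fspace C Z2}) S :
  irreducible to1 E M -> irreducible to2 E N -> equivariant to1 to2 M S ->
  (S @: M <= N)%VS -> (S @: M)%VS != 0%VS ->
  (M :&: lker S)%VS = 0%VS /\ (S @: M)%VS = N.
Proof.
move=> irrM [_ _ irrN] eqS SMN SM0; split; first exact: schur_inj eqS SM0.
case: irrM => _ stM _.
by case: (irrN _ SMN (stable_limg stM eqS)) => // /eqP; rewrite (negPf SM0).
Qed.

(** The complex field is algebraically closed: the matrix of S^-1 S' on a basis
    of [M] has an eigenvalue k, and the kernel of S' - k S is then a nonzero
    stable subspace of [M], hence [M] itself. *)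
Lemma schur_scalar M (N : {vspace fspace C Z2}) S S' :
  irreducible to1 E M -> irreducible to2 E N ->
  equivariant to1 to2 M S -> equivariant to1 to2 M S' ->
  (S @: M <= N)%VS -> (S @: M)%VS != 0%VS -> (S' @: M <= N)%VS ->
  exists k : C, forall f, f \in M -> S' f = k *: S f.
Proof.
move=> irrM irrN eqS eqS' SMN SM0 S'MN.
have [injS defN] := schur_bij irrM irrN eqS SMN SM0.
have [M0 stM irrM'] := irrM.
(* S maps the basis [X] of [M] to a basis [Y] of [N]: [A] is S^-1 S'. *)
pose X := vbasis M; pose Y := [tuple of map S X].
have bY : basis_of N Y by rewrite -defN limg_basis_of ?vbasisP.
pose A : 'M[C]_(\dim M) := \matrix_(i, j) coord Y j (S' X`_i).
have dM : (0 < \dim M)%N by rewrite lt0n dimv_eq0.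
have [k /eigenvalueP[r rA r0]] := eigenvalue_closed A dM.
have XM (i : 'I_(\dim M)) : X`_i \in M.
  by apply: vbasis_mem; rewrite mem_nth ?size_tuple.
pose f := \sum_i r 0 i *: X`_i.
have fM : f \in M by apply: memv_suml => i _; apply: memvZ.
have f0 : f != 0.
  apply: contraNneq r0 => f0; apply/eqP/rowP => i; rewrite mxE.
  by have /freeP := basis_free (vbasisP M) => /(_ (fun i => r 0 i) f0 i).
have Sf : S' f = k *: S f.
  rewrite /f !linear_sum /=.
  transitivity (\sum_i \sum_j (r 0 i * A i j) *: Y`_j).
    apply: eq_bigr => i _; rewrite linearZ /=.
    rewrite {1}(coord_basis bY (v := S' X`_i)); last first.
      by apply: (subvP S'MN); apply: memv_img.
    by rewrite scaler_sumr; apply: eq_bigr => j _; rewrite scalerA mxE.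
  rewrite exchange_big; apply: eq_bigr => j _ /=.
  rewrite -scaler_suml linearZ scalerA (nth_map 0) ?size_tuple //.
  congr (_ *: _).
  by have /rowP/(_ j) := rA; rewrite !mxE.
exists k => g gM; apply/eqP; rewrite -subr_eq0.
have eqT : equivariant to1 to2 M (S' - k *: S).
  move=> e h eE hM.
  by rewrite !(add_lfunE, scale_lfunE, opp_lfunE) eqS ?eqS' //
    [RHS]linearB /= [in RHS]linearZ.
case: (irrM' _ (capvSl M (lker (S' - k *: S))) (stable_ker stM eqT)) => kM.
  have : f \in (M :&: lker (S' - k *: S))%VS.
    rewrite memv_cap fM memv_ker !(add_lfunE, scale_lfunE, opp_lfunE).
    by rewrite Sf subrr eqxx.
  by rewrite kM memv0 (negPf f0).
move: gM; rewrite -kM memv_cap memv_ker => /andP[_].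
by rewrite !(add_lfunE, scale_lfunE, opp_lfunE).
Qed.

End TwoActions.

Section OneAction.
Variables (D : {set gT}) (Z : finType) (to : action D Z).
Implicit Types M N : {vspace fspace C Z}.

Lemma stable_add M N :
  stable to E M -> stable to E N -> stable to E (M + N).
Proof.
move=> stM stN g f gE /memv_addP[m mM [n nN ->]].
by rewrite linearD; apply: memv_add; [apply: stM | apply: stN].
Qed.

Lemma stable_sum (I : Type) (s : seq I) (p : pred I)
    (M : I -> {vspace fspace C Z}) :
  (forall i, p i -> stable to E (M i)) ->
  stable to E (\sum_(i <- s | p i) M i)%VS.
Proof.
move=> stM; elim/big_ind: _ => //; last exact: stable_add.
by move=> g f _; rewrite !memv0 => /eqP->; rewrite linear0.
Qed.

Lemma stable_cap M N :
  stable to E M -> stable to E N -> stable to E (M :&: N).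
Proof.
move=> stM stN g f gE; rewrite !memv_cap => /andP[fM fN].
by rewrite stM ?stN.
Qed.

Lemma irreducible_cap_eq0 M N :
  irreducible to E M -> stable to E N -> ~~ (M <= N)%VS -> (M :&: N)%VS = 0%VS.
Proof.
move=> [_ stM irrM] stN sMN.
have [//|MN] := irrM _ (capvSl M N) (stable_cap stM stN).
by rewrite -MN capvSr in sMN.
Qed.

(** Descent on the dimension produces an irreducible subspace of [M]; a boolean
    conclusion lets one use it although irreducibility, which quantifies over
    all subspaces, is not decided constructively. *)
Lemma irreducible_sub_ind M (b : bool) : M != 0%VS -> stable to E M ->
  (forall M0 : {vspace fspace C Z}, (M0 <= M)%VS -> irreducible to E M0 -> b) ->
  b.
Proof.
have [n] := ubnP (\dim M); elim: n M => // n IHn M dM M0 stM irr_b.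
have [//|nb] := boolP b; case/negP: (nb).
apply: (irr_b M) => //; split=> // N sNM stN.
have [->|N0] := eqVneq N 0%VS; [by left | right].
apply: contraTeq isT => neqNM; case/negP: nb.
have ltNM : (\dim N < \dim M)%N.
  rewrite ltn_neqAle dimvS // andbT; apply: contraNneq neqNM => dNM.
  by rewrite eqEdim sNM dNM leqnn.
apply: (IHn N _ N0 stN) => [|M1 sM1]; first exact: leq_trans ltNM _.
by apply: irr_b; apply: subv_trans sNM.
Qed.

Lemma equivalent_irreducible M N :
  equivalent to E M N -> stable to E M -> irreducible to E N ->
  irreducible to E M.
Proof.
move=> [S [kerS defN] eqS] stM [N0 stN irrN]; split=> //.
  by apply: contraNneq N0 => M0; rewrite -defN M0 limg0.
move=> M' sM' stM'; have eqS' : equivariant to to M' S.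
  exact: (equivariantW sM').
have sSM' : (S @: M' <= N)%VS by rewrite -defN limgS.
have capM' : (M' :&: lker S)%VS = 0%VS.
  by apply/eqP; rewrite -subv0 -kerS capvC capvS.
case: (irrN _ sSM' (stable_limg stM' eqS')) => SM'.
  by left; move: capM'; rewrite (capv_idPl _) // lkerE SM'.
have dimSM : \dim (S @: M) = \dim M by apply: limg_dim_eq; rewrite capvC.
right; apply/eqP.
by rewrite eqEdim sM' -(limg_dim_eq capM') SM' -defN dimSM leqnn.
Qed.

Lemma equivalent_trans M1 M2 M3 :
  equivalent to E M1 M2 -> equivalent to E M2 M3 -> equivalent to E M1 M3.
Proof.
move=> [S [kerS defM2] eqS] [T [kerT defM3] eqT].
exists (T \o S)%VF; last first.
  move=> g f gE fM; rewrite !comp_lfunE eqS // eqT // -defM2.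
  exact: memv_img.
split; last by rewrite limg_comp defM2.
apply/eqP; rewrite -subv0; apply/subvP => f.
rewrite memv_cap memv_ker => /andP[].
rewrite comp_lfunE => /eqP TSf fM; rewrite -kerS memv_cap fM andbT memv_ker.
rewrite -memv0 -kerT memv_cap memv_ker TSf eqxx -defM2; exact: memv_img.
Qed.

(** Induction on the summands [M], with [S] the sum of the remaining ones.  If
    [N] is not inside [S] then [N] and [M] both meet [S] trivially, and the
    projection of M + S onto [M] along [S] is equivariant and injective on
    [N].  The sum need not be direct for this. *)
Lemma irreducible_sub_sum (s : seq {vspace fspace C Z})
    (N : {vspace fspace C Z}) :
  {in s, forall M, irreducible to E M} -> irreducible to E N ->
  (N <= \sum_(M <- s) M)%VS -> exists2 M, M \in s & equivalent to E N M.
Proof.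
move=> irrs irrN; have [N0 stN _] := irrN.
elim: s irrs => [|M s IHs] irrs.
  by rewrite big_nil subv0 (negPf N0).
have irrM : irreducible to E M by apply: irrs; rewrite mem_head.
have stM : stable to E M by case: irrM.
have irrs' : {in s, forall M, irreducible to E M}.
  by move=> M' sM'; apply: irrs; rewrite inE sM' orbT.
rewrite big_cons; set S := (\sum_(_ <- s) _)%VS in IHs * => sN.
have stS : stable to E S.
  by rewrite /S big_seq; apply: stable_sum => M' /irrs'[].
have [/(IHs irrs')[M' sM' eqM']|sNS] := boolP (N <= S)%VS.
  by exists M'; rewrite // inE sM' orbT.
have NS0 := irreducible_cap_eq0 irrN stS sNS.
have MS0 : (M :&: S)%VS = 0%VS.
  apply: irreducible_cap_eq0 => //; apply: contraNN sNS => /addv_idPr MS.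
  by rewrite -MS.
pose p := daddv_pi M S.
have pS f : f \in S -> p f = 0.
  move=> fS; have /daddv_pi_add := MS0 => /(_ f (subvP (addvSr _ _) f fS)).
  rewrite (daddv_pi_id _ fS) 1?capvC // => /(canRL (addrK _)).
  by rewrite subrr.
have eqp : equivariant to to N p.
  move=> g f gE fN; have fMS := subvP sN _ fN.
  have := daddv_pi_add MS0 fMS; rewrite -/p; set r := daddv_pi S _ f => deff.
  have rS : r \in S by apply: memv_pi.
  have pM : p f \in M by apply: memv_pi.
  rewrite -[in LHS]deff !linearD /= (pS (perm_rep to g r)) ?addr0;
    last exact: stS.
  by apply: daddv_pi_id => //; apply: stM.
have kerp f : f \in N -> p f = 0 -> f = 0.
  move=> fN pf0; apply/eqP; rewrite -memv0 -NS0 memv_cap fN.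
  rewrite -(daddv_pi_add MS0 (subvP sN _ fN)) -/p pf0 add0r; exact: memv_pi.
have pN0 : (p @: N)%VS != 0%VS.
  apply: contraNneq N0 => pN0; rewrite -subv0; apply/subvP => f fN.
  by rewrite (kerp f fN) ?mem0v //; apply/eqP; rewrite -memv0 -pN0 memv_img.
have pNM : (p @: N <= M)%VS.
  by apply/subvP => _ /memv_imgP[f _ ->]; apply: memv_pi.
have [ker0 imp] := schur_bij irrN irrM eqp pNM pN0.
by exists M; [rewrite mem_head | exists p => //; rewrite capvC].
Qed.

(** Uniqueness of isotypic components: [W i] embeds in the sum, so it is
    equivalent to one of the copies of some [W j] that occur, and i = j by
    inequivalence. *)
Lemma decomposition_mem (M : {vspace fspace C Z}) (I : finType) (J : {set I})
    (m : I -> nat) (W : I -> {vspace fspace C Z}) i :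
  decomposition to E M J m W -> (W i <= M)%VS -> i \in J /\ (0 < m i)%N.
Proof.
move=> [irrW ineqW [V [VW _ defM]]] sWM.
pose s := flatten [seq [seq V j (k : 'I_(m j)) | k : 'I_(m j)] | j <- enum J].
have sP N : N \in s -> exists j k, [/\ j \in J, (k < m j)%N & N = V j k].
  case/flatten_mapP => j; rewrite mem_enum => jJ /mapP[k _ ->].
  by exists j, k.
have irrs : {in s, forall N, irreducible to E N}.
  move=> _ /sP[j [k [jJ km ->]]]; have [stV eqV] := VW j k jJ km.
  exact: equivalent_irreducible eqV stV (irrW j).
have sWs : (W i <= \sum_(N <- s) N)%VS.
  apply: (subv_trans sWM); rewrite defM; apply/subv_sumP => j jJ.
  apply/subv_sumP => k _.
  rewrite (big_rem (V j k)) ?addvSl //; apply/flatten_mapP.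
  by exists j; rewrite ?mem_enum // map_f ?mem_enum.
have [_ /sP[j [k [jJ km ->]]] eqN] := irreducible_sub_sum irrs (irrW i) sWs.
have [_ eqV] := VW j k jJ km.
have [->|/ineqW[]] := eqVneq i j; first by rewrite jJ (leq_ltn_trans _ km).
exact: equivalent_trans eqN eqV.
Qed.

End OneAction.
End Schur.

(** * Tensor products of function spaces, through slices *)

Section Slices.
Variables (C : numClosedFieldType) (X Y : finType).
Implicit Types (F : fspace C (X * Y)%type).
Implicit Types (V : {vspace fspace C X}) (W : {vspace fspace C Y}).

Lemma exists_nonzero (Z : finType) (M : {vspace fspace C Z}) :
  M != 0%VS -> exists2 f, f \in M & exists z, f z != 0.
Proof.
move=> M0; exists (vpick M); first exact: memv_pick.
apply/existsP; apply: contraNT M0; rewrite negb_exists -vpick0 => /forallP v0.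
by apply/eqP/ffunP => z; apply/eqP; rewrite ffunE -[_ == _]negbK v0.
Qed.

Definition xslice x F : fspace C Y := [ffun y => F (x, y)].
Definition yslice y F : fspace C X := [ffun x => F (x, y)].
(** Declaring a linear structure in the left factor requires it to come last. *)
Definition tensr (w : fspace C Y) (v : fspace C X) := tens v w.

Fact xslice_is_linear x : linear (xslice x).
Proof. by move=> k u v; apply/ffunP => y; rewrite !ffunE. Qed.
HB.instance Definition _ x :=
  GRing.isLinear.Build C (fspace C (X * Y)%type) (fspace C Y) _ (xslice x)
    (xslice_is_linear x).

Fact yslice_is_linear y : linear (yslice y).
Proof. by move=> k u v; apply/ffunP => x; rewrite !ffunE. Qed.
HB.instance Definition _ y :=
  GRing.isLinear.Build C (fspace C (X * Y)%type) (fspace C X) _ (yslice y)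
    (yslice_is_linear y).

Fact tens_is_linear (v : fspace C X) : linear (@tens C X Y v).
Proof.
by move=> k u w; apply/ffunP => p; rewrite !ffunE mulrDr /GRing.scale /= mulrCA.
Qed.
HB.instance Definition _ (v : fspace C X) :=
  GRing.isLinear.Build C (fspace C Y) (fspace C (X * Y)%type) _ (@tens C X Y v)
    (tens_is_linear v).

Fact tensr_is_linear (w : fspace C Y) : linear (tensr w).
Proof.
by move=> k u v; apply/ffunP => p; rewrite !ffunE mulrDl /GRing.scale /= mulrA.
Qed.
HB.instance Definition _ (w : fspace C Y) :=
  GRing.isLinear.Build C (fspace C X) (fspace C (X * Y)%type) _ (tensr w)
    (tensr_is_linear w).

Lemma xsliceP F F' : (forall x, xslice x F = xslice x F') -> F = F'.
Proof.
move=> eqF; apply/ffunP => -[x y].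
by have /ffunP/(_ y) := eqF x; rewrite !ffunE.
Qed.

Lemma xslice_tens x (v : fspace C X) (w : fspace C Y) :
  xslice x (tens v w) = v x *: w.
Proof. by apply/ffunP => y; rewrite !ffunE. Qed.

Lemma yslice_tens y (v : fspace C X) (w : fspace C Y) :
  yslice y (tens v w) = w y *: v.
Proof. by apply/ffunP => x; rewrite !ffunE mulrC. Qed.

Lemma tens_span_mem (s : seq (fspace C X)) (t : seq (fspace C Y))
    (M : {vspace fspace C (X * Y)%type}) v w :
  (forall a b, a \in s -> b \in t -> tens a b \in M) ->
  v \in <<s>>%VS -> w \in <<t>>%VS -> tens v w \in M.
Proof.
move=> stM vs wt.
have sM b : b \in t -> tens v b \in M.
  move=> tb; have /span_subvP/subvP/(_ v vs) :
      {subset s <= linfun (tensr b) @^-1: M}%VS.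
    by move=> a sa; rewrite -memv_preim lfunE; apply: stM.
  by rewrite -memv_preim lfunE.
have /span_subvP/subvP/(_ w wt) :
    {subset t <= linfun (@tens C X Y v) @^-1: M}%VS.
  by move=> b tb; rewrite -memv_preim lfunE; apply: sM.
by rewrite -memv_preim lfunE.
Qed.

Lemma tensv_sub V W (M : {vspace fspace C (X * Y)%type}) :
  (forall v w, v \in V -> w \in W -> tens v w \in M) -> (tensv V W <= M)%VS.
Proof.
move=> VWM; apply/span_subvP => _ /allpairsP[[v w] [vV wW ->]].
by apply: VWM; apply: vbasis_mem.
Qed.

(** For the converse, expand each slice F(x, .) on a basis of [W]: the
    coefficients, as functions of x, are linear combinations of the slices
    F(., y) and so belong to [V]. *)
Lemma tensvP V W F :
  F \in tensv V W <->
  (forall x, xslice x F \in W) /\ (forall y, yslice y F \in V).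
Proof.
split=> [FVW | [FW FV]].
  split=> z; [have : (tensv V W <= linfun (xslice z) @^-1: W)%VS
             |have : (tensv V W <= linfun (yslice z) @^-1: V)%VS].
  - apply: tensv_sub => v w vV wW; rewrite -memv_preim lfunE /= xslice_tens.
    exact: memvZ.
  - by move/subvP/(_ F FVW); rewrite -memv_preim lfunE.
  - apply: tensv_sub => v w vV wW; rewrite -memv_preim lfunE /= yslice_tens.
    exact: memvZ.
  - by move/subvP/(_ F FVW); rewrite -memv_preim lfunE.
pose c j : fspace C X := [ffun x => coord (vbasis W) j (xslice x F)].
pose delta y : fspace C Y := [ffun y' => (y' == y)%:R].
have -> : F = \sum_j tens (c j) (vbasis W)`_j.
  apply/ffunP => -[x y]; rewrite sum_ffunE.
  have /ffunP/(_ y) := coord_vbasis (FW x); rewrite ffunE => ->.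
  by rewrite sum_ffunE; apply: eq_bigr => j _; rewrite !ffunE.
apply: memv_suml => j _; apply: mem_tensv; last first.
  by apply: vbasis_mem; rewrite mem_nth ?size_tuple.
have -> : c j = \sum_y coord (vbasis W) j (delta y) *: yslice y F.
  apply/ffunP => x; rewrite sum_ffunE ffunE.
  have -> : xslice x F = \sum_y F (x, y) *: delta y.
    apply/ffunP => y; rewrite sum_ffunE ffunE (bigD1 y) //= big1 => [|y' ney].
      by rewrite !ffunE eqxx addr0 /GRing.scale /= mulr1.
    by rewrite !ffunE eq_sym (negPf ney) scaler0.
  rewrite linear_sum; apply: eq_bigr => y _.
  by rewrite linearZ !ffunE /GRing.scale /= mulrC.
by apply: memv_suml => y _; apply: memvZ.
Qed.

Lemma tensv_neq0 V W : V != 0%VS -> W != 0%VS -> tensv V W != 0%VS.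
Proof.
rewrite -(vpick0 V) -(vpick0 W) => /eqP v0 /eqP w0; apply/eqP => VW0.
have : tens (vpick V) (vpick W) \in tensv V W.
  by apply: mem_tensv; apply: memv_pick.
rewrite VW0 memv0 => /eqP/ffunP t0; case: v0; apply/ffunP => x.
apply/eqP; rewrite ffunE; apply: contra_notT w0 => vx; apply/ffunP => y.
by have /eqP := t0 (x, y); rewrite !ffunE mulf_eq0 (negPf vx) => /eqP.
Qed.

Lemma inner_tens (f f' : fspace C X) (g g' : fspace C Y) :
  inner (tens f g) (tens f' g') = inner f f' * inner g g'.
Proof.
rewrite /inner mulr_suml.
transitivity (\sum_x \sum_y (f x * (f' x)^*) * (g y * (g' y)^*)).
  by rewrite pair_bigA; apply: eq_bigr => p _; rewrite !ffunE rmorphM mulrACA.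
by apply: eq_bigr => x _; rewrite mulr_sumr.
Qed.

Lemma orthonormal_tens (I J : finType) (v : I -> fspace C X)
    (w : J -> fspace C Y) V W :
  orthonormal_basis v V -> orthonormal_basis w W ->
  orthonormal_basis (fun ij : I * J => tens (v ij.1) (w ij.2)) (tensv V W).
Proof.
move=> [onv defV] [onw defW]; split=> [[i j] [i' j'] | ].
  by rewrite inner_tens onv onw -natrM mulnb.
apply/eqP; rewrite eqEsubv; apply/andP; split.
  apply/span_subvP => _ /codomP[[i j] ->].
  by apply: mem_tensv; rewrite -?defV -?defW memv_span ?codom_f.
apply: tensv_sub => f g; rewrite -defV -defW; apply: tens_span_mem.
move=> _ _ /codomP[i ->] /codomP[j ->]; apply: memv_span.
exact: (codom_f (fun ij => tens (v ij.1) (w ij.2)) (i, j)).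
Qed.

End Slices.

(** * Irreducibility of outer tensor products *)

Section OuterTensor.
Variables (C : numClosedFieldType) (gT fT : finGroupType) (X Y : finType).
Variables (toX : {action gT &-> X}) (toY : {action fT &-> Y}).

(** L(X x Y) as a representation of the second group alone, so that Schur's
    lemma applies to the slices L(X x Y) -> L(Y). *)
Definition snd_act (p : X * Y) (c : fT) : X * Y := (p.1, toY p.2 c).

Fact snd_act1 : snd_act^~ 1%g =1 id.
Proof. by case=> x y; rewrite /snd_act act1. Qed.
Fact snd_actM p : act_morph snd_act p.
Proof. by move=> c d; rewrite /snd_act actM. Qed.
Definition snd_action : {action fT &-> X * Y} := TotalAction snd_act1 snd_actM.

Lemma xslice_snd x c (F : fspace C (X * Y)%type) :
  xslice x (perm_rep snd_action c F) = perm_rep toY c (xslice x F).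
Proof. by apply/ffunP => y; rewrite !ffunE. Qed.

(** Take [M1] inside [M] irreducible under the second group.  Each slice map
    M1 -> W is a scalar multiple k(x) of a fixed nonzero one, which is
    bijective, so [M1] consists of the k (x) w with w in [W], and k lies in [V].
    The v such that all v (x) w lie in [M] form a stable subspace of [V]
    containing k <> 0, hence all of [V]. *)
Lemma outer_tensor_irreducible (G : {set gT}) (H : {set fT})
    (V : {vspace fspace C X}) (W : {vspace fspace C Y})
    (M : {vspace fspace C (X * Y)%type}) :
  irreducible toX G V -> irreducible toY H W ->
  (M <= tensv V W)%VS -> M != 0%VS -> stable snd_action H M ->
  (forall g v w, g \in G -> tens v w \in M ->
     tens (perm_rep toX g v) w \in M) ->
  M = tensv V W.
Proof.
move=> [_ stV irrV] irrW sMVW M0 stM stMG; apply/eqP.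
apply: (irreducible_sub_ind M0 stM) => M1 sM1M irrM1.
have sM1 := subv_trans sM1M sMVW.
have [M10 _ _] := irrM1.
pose S x : 'Hom(_, _) := linfun (@xslice C X Y x).
have eqS x : equivariant H snd_action toY M1 (S x).
  by move=> c F _ _; rewrite !lfunE /= xslice_snd.
have SM1 x : (S x @: M1 <= W)%VS.
  apply/subvP => _ /memv_imgP[F FM1 ->]; rewrite lfunE.
  by have /tensvP[/(_ x)] := subvP sM1 _ FM1.
have [F0 F0M1 [[x1 y1] F0nz]] := exists_nonzero M10.
have SM10 : (S x1 @: M1)%VS != 0%VS.
  apply: contraNneq F0nz => SM10.
  have : S x1 F0 \in (S x1 @: M1)%VS by apply: memv_img.
  by rewrite SM10 memv0 lfunE => /eqP/ffunP/(_ y1); rewrite !ffunE => ->.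
have [k defk] := fin_all_exists (fun x =>
  schur_scalar irrM1 irrW (eqS x1) (eqS x) (SM1 x1) SM10 (SM1 x)).
pose v0 : fspace C X := [ffun x => k x].
have defM1 F : F \in M1 -> F = tens v0 (xslice x1 F).
  move=> FM1; apply/ffunP => -[x y]; rewrite !ffunE.
  by have /ffunP/(_ y) := defk x F FM1; rewrite !lfunE /= !ffunE.
have v0V : v0 \in V.
  have /tensvP[_ /(_ y1)] := subvP sM1 _ F0M1.
  by rewrite {1}(defM1 _ F0M1) yslice_tens ffunE rpredZeq (negPf F0nz).
have v0M w : w \in W -> tens v0 w \in M.
  have [_ <-] := schur_bij irrM1 irrW (eqS x1) (SM1 x1) SM10.
  by case/memv_imgP=> F FM1 ->; rewrite lfunE -defM1 // (subvP sM1M).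
pose V' := (V :&:
  \bigcap_(i < \dim W) (linfun (tensr (vbasis W)`_i) @^-1: M))%VS.
have V'P v : v \in V' <-> v \in V /\ forall w, w \in W -> tens v w \in M.
  rewrite memv_cap; split=> [/andP[vV /subv_bigcapP vM] | [vV vM]].
    split=> // w; rewrite -(span_basis (vbasisP W)).
    apply: (tens_span_mem (s := [:: v])); last exact: memv_span1.
    move=> a b; rewrite inE => /eqP-> /(nthP 0)[i].
    rewrite size_tuple => ltiW <-.
    by have := vM (Ordinal ltiW) isT; rewrite -memvE -memv_preim lfunE.
  rewrite vV; apply/subv_bigcapP => i _; rewrite -memvE -memv_preim lfunE.
  by apply: vM; apply: vbasis_mem; rewrite mem_nth ?size_tuple.
have stV' : stable toX G V'.
  move=> g v gG /V'P[vV vM]; apply/V'P; split=> [|w wW]; first exact: stV.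
  by apply: stMG => //; apply: vM.
have v0V' : v0 \in V' by apply/V'P.
have [V'0 | V'V] := irrV _ (capvSl _ _) stV'.
  case/negP: F0nz; move: v0V'; rewrite /V' V'0 memv0 => /eqP v00.
  by rewrite (defM1 _ F0M1) v00 !ffunE mul0r.
rewrite eqEsubv sMVW; apply: tensv_sub => v w; rewrite -V'V => /V'P[_].
exact.
Qed.

End OuterTensor.

(** * Invariant partitions and functions constant on their parts *)

Section PermutationRepresentationTheory.
Variables (C : numClosedFieldType) (gT : finGroupType) (Z : finType).

Lemma perm_repE (D : {set gT}) (to : action D Z) g (f : fspace C Z) z :
  perm_rep to g f z = f (to z g).
Proof. by rewrite ffunE /lact invgK. Qed.

Variable to : {action gT &-> Z}.

Lemma perm_repM g h (f : fspace C Z) :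
  perm_rep to (g * h)%g f = perm_rep to g (perm_rep to h f).
Proof. by apply/ffunP => z; rewrite !perm_repE actM. Qed.

Lemma perm_rep1 (f : fspace C Z) : perm_rep to 1%g f = f.
Proof. by apply/ffunP => z; rewrite perm_repE act1. Qed.

End PermutationRepresentationTheory.

Section Parts.
Variables (C : numClosedFieldType) (gT : finGroupType) (Z : finType).
Variables (to : {action gT &-> Z}) (P : {set {set Z}}).
Hypotheses (partP : partition P [set: Z]).
Hypotheses (invP : [acts [set: gT], on P | to^*]).

Lemma part_of z : exists2 A, A \in P & z \in A.
Proof.
have zP : z \in cover P by rewrite (cover_partition partP) inE.
by exists (pblock P z); rewrite ?pblock_mem ?mem_pblock.
Qed.

Lemma part_unique A B z : A \in P -> B \in P -> z \in A -> z \in B -> A = B.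
Proof.
have [_ tiP _] := and3P partP => AP BP zA zB.
by rewrite -(def_pblock tiP AP zA) (def_pblock tiP BP zB).
Qed.

Lemma setact_part A g : A \in P -> to^*%act A g \in P.
Proof. by move=> AP; rewrite (acts_act invP) ?inE. Qed.

Lemma setact_part_eq A B g z :
  A \in P -> B \in P -> z \in A -> to z g \in B -> to^*%act A g = B.
Proof.
move=> AP BP zA zgB.
exact: (part_unique (setact_part g AP) BP (mem_setact to g zA) zgB).
Qed.

Lemma mem_part_norm A g z : A \in P -> z \in A -> to z g \in A ->
  g \in ('N(A | to))%g.
Proof.
move=> AP zA zgA; rewrite -astab1_set; apply/astab1P.
exact: setact_part_eq zgA.
Qed.

Lemma const_on_parts_stable : stable to [set: gT] (const_on_parts C P).
Proof.
move=> g f _ /const_on_partsP fP; apply/const_on_partsP => B z z' BP zB z'B.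
by rewrite !perm_repE; apply: (fP _ _ _ (setact_part g BP)); apply: mem_setact.
Qed.

Lemma parts_kernel_fix u (f : fspace C Z) :
  u \in parts_kernel to P -> f \in const_on_parts C P -> perm_rep to u f = f.
Proof.
move=> uN /const_on_partsP fP; apply/ffunP => z; rewrite perm_repE.
have [B BP zB] := part_of z; apply: (fP B) => //.
by rewrite -(astab_act uN BP) mem_setact.
Qed.

Lemma parts_kernel_fixP (f : fspace C Z) :
  (forall B, B \in P -> [transitive parts_kernel to P, on B | to]) ->
  (forall u, u \in parts_kernel to P -> perm_rep to u f = f) ->
  f \in const_on_parts C P.
Proof.
move=> transN fixf; apply/const_on_partsP => B z z' BP zB z'B.
have [u uN ->] := atransP2 (transN B BP) zB z'B.
by rewrite -perm_repE fixf.
Qed.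

(** If [i] is in [J], some copy of [W i] lies in L(P), where the kernel acts
    trivially; it then acts trivially on the equivalent [W i] too, which
    therefore consists of functions constant on parts.  That a copy exists,
    [b i > 0], follows from the decomposition of the whole space. *)
Lemma irreducible_decomposition_const (I : finType) (J : {set I})
    (b : I -> nat) (W : I -> {vspace fspace C Z}) i :
  (forall B, B \in P -> [transitive parts_kernel to P, on B | to]) ->
  decomposition to [set: gT] fullv [set: I] b W ->
  decomposition to [set: gT] (const_on_parts C P) J b W ->
  (W i <= const_on_parts C P)%VS = (i \in J).
Proof.
move=> transN decY decP; apply/idP/idP => [sWP | iJ].
  by have [] := decomposition_mem decP sWP.
have [_ bi] := decomposition_mem decY (subvf (W i)).
have [_ _ [V [VW _ defP]]] := decP.
have [_ [S [_ defW] eqS]] := VW i 0%N iJ bi.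
have sVP : (V i 0%N <= const_on_parts C P)%VS.
  rewrite defP; apply: (sumv_sup i) => //.
  exact: (sumv_sup (Ordinal bi)).
apply/subvP => f; rewrite -defW => /memv_imgP[h hV ->].
apply: parts_kernel_fixP => // u uN; rewrite -eqS ?inE //.
by rewrite (parts_kernel_fix uN) // (subvP sVP).
Qed.

End Parts.

(** * Restriction to a part and extension by zero *)

Section Restriction.
Variables (C : numClosedFieldType) (X : finType) (A0 : {set X}).
Local Notation sub := {x | x \in A0}.

Definition res (f : fspace C X) : fspace C sub := [ffun z => f (val z)].

Fact res_is_linear : linear res.
Proof. by move=> k u v; apply/ffunP => x; rewrite !ffunE. Qed.
HB.instance Definition _ :=
  GRing.isLinear.Build C (fspace C X) (fspace C sub) _ res res_is_linear.

Lemma ext0_val (f : fspace C sub) z : ext0 f (val z) = f z.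
Proof. by rewrite ffunE valK. Qed.

Lemma ext0_out (f : fspace C sub) x : x \notin A0 -> ext0 f x = 0.
Proof. by move=> xA0; rewrite ffunE insubN. Qed.

Lemma ext0K (f : fspace C sub) : res (ext0 f) = f.
Proof. by apply/ffunP => z; rewrite ffunE ext0_val. Qed.

Lemma resK (f : fspace C X) :
  (forall x, x \notin A0 -> f x = 0) -> ext0 (res f) = f.
Proof.
move=> f0; apply/ffunP => x.
have [xA0|xA0] := boolP (x \in A0); last by rewrite ext0_out ?f0.
by rewrite -[x]/(val (exist (fun x => x \in A0) x xA0)) ext0_val ffunE.
Qed.

Lemma inner_ext0 (f g : fspace C sub) : inner (ext0 f) (ext0 g) = inner f g.
Proof.
rewrite /inner (bigID (fun x => x \in A0)) /= [X in _ + X]big1 ?addr0.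
  by rewrite big_sub /=; apply: eq_bigr => z _; rewrite !ext0_val.
by move=> x xA0; rewrite ext0_out ?mul0r.
Qed.

Lemma orthonormal_ext0 (I : finType) (u : I -> fspace C sub)
    (U : {vspace fspace C sub}) :
  orthonormal_basis u U ->
  orthonormal_basis (fun i => ext0 (u i)) (linfun (@ext0 C X A0) @: U).
Proof.
move=> [onu defU]; split=> [i j|]; first by rewrite inner_ext0.
rewrite -defU limg_span /codom -map_comp; congr <<_>>%VS.
by apply: eq_map => i; rewrite /= lfunE.
Qed.

Variables (gT : finGroupType) (to : {action gT &-> X}).
Local Notation T := ('N(A0 | to))%g.

Lemma val_stab_subact (z : sub) t :
  t \in T -> val (to^?%act z t) = to (val z) t.
Proof.
move=> tT; rewrite val_subact /subact_dom.
have -> : [set x | x \in A0] = A0 by apply/setP=> x; rewrite inE.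
by rewrite tT.
Qed.

Lemma ext0_perm_rep t (f : fspace C sub) :
  t \in T -> ext0 (perm_rep to^? t f) = perm_rep to t (ext0 f).
Proof.
move=> tT; apply/ffunP => x; rewrite perm_repE.
have [xA0|xA0] := boolP (x \in A0);
  last by rewrite !ext0_out ?(astabs_act _ tT).
rewrite -[x]/(val (exist (fun x => x \in A0) x xA0)) ext0_val perm_repE.
by rewrite -ext0_val val_stab_subact.
Qed.

Lemma irreducible_ext0 (U : {vspace fspace C sub}) :
  irreducible to^? T U -> irreducible to T (linfun (@ext0 C X A0) @: U).
Proof.
have eqe M : equivariant T to^? to M (linfun (@ext0 C X A0)).
  by move=> t f tT _; rewrite !lfunE /= ext0_perm_rep.
have ker0 : lker (linfun (@ext0 C X A0)) = 0%VS.
  apply/eqP; rewrite -subv0; apply/subvP => f.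
  by rewrite memv_ker lfunE memv0 /= -{2}[f]ext0K => /eqP->; rewrite linear0.
move=> [U0 stU irrU]; split; first 1 last.
- exact: stable_limg stU (eqe U).
- move=> M sM stM.
  have defM : (linfun (@ext0 C X A0) @:
      (U :&: linfun (@ext0 C X A0) @^-1: M) = M)%VS.
    apply/eqP; rewrite eqEsubv; apply/andP; split; apply/subvP => f.
      by case/memv_imgP=> h /memv_capP[_]; rewrite -memv_preim => hM ->.
    move=> fM; have /memv_imgP[h hU deff] := subvP sM f fM.
    by rewrite deff memv_img // memv_cap hU -memv_preim -deff.
  have [] := irrU _ (capvSl _ _) (stable_preim stU (eqe U) stM).
    by move=> U'0; left; rewrite -defM U'0 limg0.
  by move=> U'U; right; rewrite -[LHS]defM U'U.
by rewrite -lkerE ker0 subv0.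
Qed.

End Restriction.

(** * The induced representation inside L(X) *)

Section Induced.
Variables (C : numClosedFieldType) (gT : finGroupType) (X : finType).
Variables (to : {action gT &-> X}) (P : {set {set X}}).
Hypotheses (partP : partition P [set: X]).
Hypotheses (invP : [acts [set: gT], on P | to^*]).
Variables (A0 : {set X}) (l : {set X} -> gT).
Hypotheses (A0P : A0 \in P).
Hypotheses (lA : forall A, A \in P -> [set lact to (l A) x | x in A0] = A).
Variable U : {vspace fspace C {x | x \in A0}}.
Hypothesis stU : stable to^? ('N(A0 | to))%g U.

Lemma mem_translate A x : A \in P -> (to x (l A) \in A0) = (x \in A).
Proof.
move=> AP; apply/idP/idP => [xA|].
  by rewrite -(lA AP); apply/imsetP; exists (to x (l A)); rewrite // /lact actK.
by rewrite -{1}(lA AP) => /imsetP[y yA0 ->]; rewrite /lact actKV.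
Qed.

(** A translate of A_0 either is A_0, and then the translating element is in
    the stabilizer, or is disjoint from it. *)
Lemma res_perm_rep_ext0 f t :
  f \in U -> res A0 (perm_rep to t (ext0 f)) \in U.
Proof.
move=> fU; have [tT | tT] := boolP (t \in ('N(A0 | to))%g).
  by rewrite -ext0_perm_rep // ext0K; apply: stU.
suff -> : res A0 (perm_rep to t (ext0 f)) = 0 by apply: mem0v.
apply/ffunP => z; rewrite ffunE perm_repE ext0_out ?ffunE //.
by apply: contra tT; apply: (mem_part_norm partP invP A0P (valP z)).
Qed.

(** A description that involves no coset representatives, and from which
    stability under the whole group is immediate. *)
Lemma inducedP f :
  f \in induced to P l U <-> forall g, res A0 (perm_rep to g f) \in U.
Proof.
split=> [/memv_sumP[h hU ->] g | fU].
  rewrite !linear_sum; apply: memv_suml => A AP /=.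
  have /memv_imgP[_ /memv_imgP[f0 f0U ->] ->] := hU A AP.
  by rewrite !lfunE /= -perm_repM res_perm_rep_ext0.
pose h A := perm_rep to (l A) (ext0 (res A0 (perm_rep to (l A)^-1 f))).
have hE A x : A \in P -> h A x = if x \in A then f x else 0.
  move=> AP; rewrite perm_repE -mem_translate //.
  case: ifP => [xA|/negbT/ext0_out-> //].
  rewrite -[to x _]/(val (exist (fun x => x \in A0) _ xA)) ext0_val ffunE.
  by rewrite perm_repE /= actK.
have -> : f = \sum_(A in P) h A.
  apply/ffunP => x; have [B BP xB] := part_of partP x.
  rewrite sum_ffunE (bigD1 B) //= hE // xB big1 ?addr0 // => A /andP[AP neAB].
  rewrite hE //; case: ifP => // xA; case/eqP: neAB.
  exact: (part_unique partP AP BP xA xB).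
apply: memv_sumr => A AP.
have -> : h A = linfun (perm_rep to (l A)) (linfun (@ext0 C X A0)
    (res A0 (perm_rep to (l A)^-1 f))) by rewrite !lfunE.
by rewrite !memv_img.
Qed.

Lemma induced_stable : stable to [set: gT] (induced to P l U).
Proof.
move=> g f _ /inducedP fU; apply/inducedP => h.
by rewrite -perm_repM.
Qed.

Lemma induced_supported f : f \in induced to P l U ->
  (forall x, x \notin A0 -> f x = 0) -> f \in (linfun (@ext0 C X A0) @: U)%VS.
Proof.
move=> /inducedP/(_ 1%g) fU f0; rewrite perm_rep1 in fU.
have -> : f = linfun (@ext0 C X A0) (res A0 f) by rewrite lfunE /= resK.
exact: memv_img.
Qed.

Lemma ext0_induced f : f \in U -> ext0 f \in induced to P l U.
Proof. by move=> fU; apply/inducedP => t; apply: res_perm_rep_ext0. Qed.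

End Induced.

(** * The crested product acting on slices *)

Section Crested.
Variables (C : numClosedFieldType) (gT fT : finGroupType) (X Y : finType).
Variables (toX : {action gT &-> X}) (toY : {action fT &-> Y}).
Variables (P : {set {set X}}) (Q : {set {set Y}}).
Hypotheses (partP : partition P [set: X]) (partQ : partition Q [set: Y]).
Hypotheses (invP : [acts [set: gT], on P | toX^*]).
Hypotheses (invQ : [acts [set: fT], on Q | toY^*]).
Hypothesis transN : forall B, B \in Q ->
  [transitive parts_kernel toY Q, on B | toY].
Variables (x0 : X) (y0 : Y).

Local Notation wr := (wreath fT toX).
Local Notation to := (wreath_action toX toY).
Local Notation E := (crested toX toY P Q).
Local Notation N := (parts_kernel toY Q).
Local Notation R := ('C_E[(x0, y0) | to])%g.
Local Notation LQ := (const_on_parts C Q).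
Implicit Types (v : fspace C X) (w : fspace C Y) (F : fspace C (X * Y)%type).
Implicit Type u : wr.

Lemma crestedP u :
  u \in E <-> exists n c, [/\ forall x, n x \in N,
    forall A x x', A \in P -> x \in A -> x' \in A -> n x = n x' &
    forall x, u.1 x = (n x * c)%g].
Proof.
rewrite inE; split.
  case/mulsgP=> n _ nN /imsetP[c _ ->] ->; exists n, c.
  move: nN; rewrite inE => /andP[/forallP nN /forall_inP nP].
  split=> [//|A x x' AP xA x'A|x]; last by rewrite !ffunE.
  by have /forall_inP/(_ x xA)/forall_inP/(_ x' x'A)/eqP := nP A AP.
move=> [n [c [nN nP defu]]]; apply/mulsgP.
exists [ffun x => n x] [ffun=> c]; [|exact: imset_f|]; last first.
  by apply/ffunP => x; rewrite !ffunE defu.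
rewrite inE; apply/andP; split; first by apply/forallP => x; rewrite ffunE.
apply/forall_inP => A AP; apply/forall_inP => x xA; apply/forall_inP => x' x'A.
by rewrite !ffunE (nP A x x').
Qed.

Lemma crested_diag c g : (([ffun=> c], g) : wr) \in E.
Proof.
apply/crestedP; exists (fun=> 1%g), c.
by split=> // x; rewrite ?group1 // ffunE mul1g.
Qed.

(** These elements separate one part from the others; the fine case rests on
    them. *)
Lemma crested_kernel A n n' : A \in P -> n \in N -> n' \in N ->
  (([ffun x => if x \in A then n else n'], 1%g) : wr) \in E.
Proof.
move=> AP nN n'N; apply/crestedP.
exists (fun x => if x \in A then n else n'), 1%g.
split=> [x|B x x' BP xB x'B|x]; first by case: ifP.
  have inA z : z \in B -> (z \in A) = (A == B).
    move=> zB; apply/idP/eqP => [zA|->//].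
    exact: (part_unique partP AP BP zA zB).
  by rewrite !inA.
by rewrite ffunE mulg1.
Qed.

Lemma crested_part u A x x' :
  u \in E -> A \in P -> x \in A -> x' \in A -> u.1 x = u.1 x'.
Proof.
by case/crestedP=> n [c [_ nP defu]] AP xA x'A; rewrite !defu (nP A x x').
Qed.

Lemma crested_const u x x' w :
  u \in E -> w \in LQ -> perm_rep toY (u.1 x) w = perm_rep toY (u.1 x') w.
Proof.
case/crestedP=> n [c [nN _ defu]] wQ; rewrite !defu !perm_repM.
have cwQ : perm_rep toY c w \in LQ.
  by apply: const_on_parts_stable; rewrite ?inE.
by rewrite !(parts_kernel_fix partQ _ cwQ).
Qed.

Lemma xslice_wreath x u F :
  xslice x (perm_rep to u F) = perm_rep toY (u.1 x) (xslice (toX x u.2) F).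
Proof.
apply/ffunP => y; rewrite [LHS]ffunE [LHS]perm_repE [RHS]perm_repE [RHS]ffunE.
congr (F _).
by rewrite /= /wreath_ract /wreath_lact /= ffunE /lact !invgK actK.
Qed.

(** The action of (f, g) on v (x) w is again decomposable as soon as f(x) w is
    independent of x on the support of g v. *)
Lemma perm_rep_tens u v w w' :
  (forall x, v (toX x u.2) != 0 -> perm_rep toY (u.1 x) w = w') ->
  perm_rep to u (tens v w) = tens (perm_rep toX u.2 v) w'.
Proof.
move=> uw; apply: xsliceP => x.
rewrite xslice_wreath !xslice_tens perm_repE linearZ /=.
by have [->|/uw->//] := eqVneq (v (toX x u.2)) 0; rewrite !scale0r.
Qed.

Lemma perm_rep_snd c F :
  perm_rep (snd_action X toY) c F = perm_rep to (([ffun=> c], 1%g) : wr) F.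
Proof.
by apply: xsliceP => x; rewrite xslice_snd xslice_wreath /= ffunE act1.
Qed.

Lemma perm_rep_tensl g v w :
  perm_rep to (([ffun=> 1%g], g) : wr) (tens v w) = tens (perm_rep toX g v) w.
Proof. by apply: perm_rep_tens => x _; rewrite ffunE perm_rep1. Qed.

Lemma stable_tensv (V : {vspace fspace C X}) (W : {vspace fspace C Y}) :
  (forall u v w, u \in E -> v \in V -> w \in W ->
     perm_rep to u (tens v w) \in tensv V W) ->
  stable to E (tensv V W).
Proof.
move=> stVW u F uE.
have : (tensv V W <= linfun (perm_rep to u) @^-1: tensv V W)%VS.
  by apply: tensv_sub => v w vV wW; rewrite -memv_preim lfunE; apply: stVW.
by move/subvP => sVW /sVW; rewrite -memv_preim lfunE.
Qed.

Lemma mem_stab u : (u \in R) =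
  [&& u \in E, u.2 \in ('C[x0 | toX])%g & u.1 x0 \in ('C[y0 | toY])%g].
Proof.
rewrite inE; congr (_ && _); rewrite -groupV.
rewrite -[u.2 \in _]groupV -[u.1 x0 \in _]groupV.
apply/astab1P/andP => [|[/astab1P gx /astab1P fy]].
  rewrite /= /wreath_ract invgK /wreath_lact /lact /= => -[gx].
  by rewrite gx => fy; split; apply/astab1P.
by rewrite /= /wreath_ract invgK /wreath_lact /lact /= gx fy.
Qed.

Lemma stab_diag c g : c \in ('C[y0 | toY])%g -> g \in ('C[x0 | toX])%g ->
  (([ffun=> c], g) : wr) \in R.
Proof. by move=> cH gK; rewrite mem_stab crested_diag /= gK ffunE. Qed.

Lemma yslice_diagl y g F :
  yslice y (perm_rep to (([ffun=> 1%g], g) : wr) F) =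
  perm_rep toX g (yslice y F).
Proof.
apply/ffunP => x.
have /ffunP/(_ y) := xslice_wreath x (([ffun=> 1%g], g) : wr) F.
by rewrite /= [in RHS]ffunE perm_rep1 perm_repE !ffunE.
Qed.

(** The stabilizer R contains H x K, acting on the two factors separately. *)
Lemma invariant_slices (V : {vspace fspace C X}) (W : {vspace fspace C Y}) F :
  F \in invariants to R (tensv V W) ->
  (forall x, xslice x F \in invariants toY 'C[y0 | toY]%g W) /\
  (forall y, yslice y F \in invariants toX 'C[x0 | toX]%g V).
Proof.
move=> /invariantsP[/tensvP[FW FV] fixF].
split=> z; apply/invariantsP; split=> // g gS.
  have := fixF _ (stab_diag gS (group1 _)) => /(congr1 (xslice z)).
  by rewrite xslice_wreath /= ffunE act1.
have := fixF _ (stab_diag (group1 _) gS) => /(congr1 (yslice z)).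
by rewrite yslice_diagl.
Qed.

(** * Representations in which N acts trivially on the second factor *)

Section Coarse.
Variables (V : {vspace fspace C X}) (W : {vspace fspace C Y}).
Hypothesis WQ : (W <= LQ)%VS.

Lemma perm_rep_tens_coarse u x v w : u \in E -> w \in W ->
  perm_rep to u (tens v w) = tens (perm_rep toX u.2 v) (perm_rep toY (u.1 x) w).
Proof.
move=> uE wW; apply: perm_rep_tens => z _.
exact: crested_const (subvP WQ w wW).
Qed.

Lemma irreducible_coarse :
  irreducible toX [set: gT] V -> irreducible toY [set: fT] W ->
  irreducible to E (tensv V W).
Proof.
move=> irrV irrW; have [V0 stV _] := irrV; have [W0 stW _] := irrW.
split; first exact: tensv_neq0.
  apply: stable_tensv => u v w uE vV wW.
  by rewrite (perm_rep_tens_coarse x0) // mem_tensv ?stV ?stW ?inE.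
move=> M sM stM; have [->|M0] := eqVneq M 0%VS; first by left.
right; apply: (outer_tensor_irreducible irrV irrW sM M0).
  by move=> c F _ FM; rewrite perm_rep_snd stM ?crested_diag.
by move=> g v w _ vwM; rewrite -perm_rep_tensl stM ?crested_diag.
Qed.

Lemma invariants_coarse :
  invariants to R (tensv V W) =
  tensv (invariants toX 'C[x0 | toX]%g V) (invariants toY 'C[y0 | toY]%g W).
Proof.
apply/eqP; rewrite eqEsubv; apply/andP; split.
  by apply/subvP => F FR; apply/tensvP; apply: invariant_slices.
apply: tensv_sub => v w /invariantsP[vV fixv] /invariantsP[wW fixw].
apply/invariantsP; split; first exact: mem_tensv.
move=> u; rewrite mem_stab => /and3P[uE uK uH].
by rewrite (perm_rep_tens_coarse x0) // fixv ?fixw.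
Qed.

Lemma spherical_coarse (I J : finType) (v : I -> fspace C X)
    (w : J -> fspace C Y) phi psi :
  (forall j, w j \in W) ->
  spherical_coefficients toX [set: gT] x0 v phi ->
  spherical_coefficients toY [set: fT] y0 w psi ->
  spherical_coefficients to E (x0, y0)
    (fun ij : I * J => tens (v ij.1) (w ij.2))
    (fun ij ij' => tens (phi ij.1 ij'.1) (psi ij.2 ij'.2)).
Proof.
move=> wW sphphi sphpsi [i j] [i' j'] u uE.
rewrite (perm_rep_tens_coarse (lact toX u.2 x0)) // inner_tens lact_wreath.
by rewrite ffunE /= sphphi ?sphpsi ?inE.
Qed.

End Coarse.

(** * Representations without N-invariant vectors in the second factor *)

Section Fine.
Variables (A0 : {set X}) (l : {set X} -> gT).
Hypotheses (A0P : A0 \in P) (x0A0 : x0 \in A0).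
Hypotheses (lA : forall A, A \in P -> [set lact toX (l A) x | x in A0] = A).
Variables (U : {vspace fspace C {x | x \in A0}}) (W : {vspace fspace C Y}).
Local Notation T := ('N(A0 | toX))%g.
Hypothesis stU : stable toX^? T U.
Hypothesis WQ0 : (W :&: LQ)%VS = 0%VS.
Local Notation IndU := (induced toX P l U).
Local Notation U' := (linfun (@ext0 C X A0) @: U)%VS.

Lemma kernel_fixed_eq0 w :
  w \in W -> (forall n, n \in N -> perm_rep toY n w = w) -> w = 0.
Proof.
move=> wW fixw; apply/eqP; rewrite -memv0 -WQ0 memv_cap wW.
exact: (parts_kernel_fixP transN).
Qed.

Lemma perm_rep_tens_part u A x v w :
  u \in E -> A \in P -> (forall z, v z != 0 -> toX z u.2^-1%g \in A) ->
  x \in A ->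
  perm_rep to u (tens v w) = tens (perm_rep toX u.2 v) (perm_rep toY (u.1 x) w).
Proof.
move=> uE AP vA xA; apply: perm_rep_tens => z /vA; rewrite actK => zA.
by rewrite (crested_part uE AP zA xA).
Qed.

(** A summand of Ind U is supported on one part, where the function part of an
    element of the crested product is constant, so its tensors with W go to
    such tensors. *)
Lemma stable_fine : stable toY [set: fT] W -> stable to E (tensv IndU W).
Proof.
move=> stW; apply: stable_tensv => u v w uE.
case/memv_sumP=> h hU -> wW.
have -> : tens (\sum_(A in P) h A) w = \sum_(A in P) tens (h A) w.
  exact: (linear_sum (tensr w)).
rewrite linear_sum; apply: memv_suml => A AP /=.
have hInd : h A \in IndU by apply: (subvP (sumv_sup A AP (subvv _))); apply: hU.
have /memv_imgP[_ /memv_imgP[f _ ->] defh] := hU A AP.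
rewrite !lfunE /= in defh.
pose x := toX (lact toX (l A) x0) u.2^-1%g.
have xA : lact toX (l A) x0 \in A by rewrite -(mem_translate lA) // /lact actKV.
rewrite (perm_rep_tens_part (x := x) _ uE (setact_part invP u.2^-1%g AP)).
- by rewrite mem_tensv ?(induced_stable partP invP) ?stW ?inE.
- move=> z; rewrite defh perm_repE => hz; apply: mem_setact.
  by rewrite -(mem_translate lA) //; apply: contraNT hz => /ext0_out->.
- exact: mem_setact.
Qed.

(** With [n] in N acting nontrivially on a nonzero slice of F over the part [A],
    subtracting F from its translate by the element that is [n] on [A] and 1
    elsewhere leaves a nonzero function living on A x Y; [l A] brings it over
    A_0. *)
Lemma exists_supported M : (M <= tensv IndU W)%VS -> stable to E M ->
  M != 0%VS ->
  exists F, [/\ F \in M, F != 0 & forall x, x \notin A0 -> xslice x F = 0].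
Proof.
move=> sM stM M0; have [F FM [[x1 y1] Fnz]] := exists_nonzero M0.
have [A AP x1A] := part_of partP x1.
have [FW _] := (tensvP _ _ _).1 (subvP sM F FM).
have [n nN nF] : exists2 n, n \in N &
    perm_rep toY n (xslice x1 F) != xslice x1 F.
  apply/exists_inP; apply: contraNT Fnz; rewrite negb_exists_in.
  move=> /forall_inP fixF; apply/eqP.
  have fix1 n : n \in N -> perm_rep toY n (xslice x1 F) = xslice x1 F.
    by move=> /fixF/negbNE/eqP.
  by have /ffunP/(_ y1) := kernel_fixed_eq0 (FW x1) fix1; rewrite !ffunE.
pose nu : wr := ([ffun x => if x \in A then n else 1%g], 1%g).
pose F1 := perm_rep to nu F - F.
have F1M : F1 \in M by rewrite rpredB // stM // crested_kernel ?group1.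
have F1E x : xslice x F1 =
    if x \in A then perm_rep toY n (xslice x F) - xslice x F else 0.
  rewrite linearB /= xslice_wreath /= act1 ffunE.
  by case: ifP => // _; rewrite perm_rep1 subrr.
pose F2 := perm_rep to (([ffun=> 1%g], (l A)^-1%g) : wr) F1.
have F2E x : xslice x F2 = xslice (lact toX (l A) x) F1.
  by rewrite xslice_wreath /= ffunE perm_rep1.
exists F2; split.
- by apply: stM => //; apply: crested_diag.
- apply: contraNneq nF => F20; rewrite -subr_eq0.
  have := F2E (toX x1 (l A)); rewrite F20 linear0 /lact actK F1E x1A.
  by move=> <-.
- move=> x xA0; rewrite F2E F1E -(mem_translate lA) // /lact actKV.
  by rewrite (negPf xA0).
Qed.

(** [exists_supported] makes [M] meet U (x) W; outer tensor products being
    irreducible, [M] contains U (x) W, and the translates of it span. *)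
Lemma irreducible_fine :
  irreducible toX^? T U -> irreducible toY [set: fT] W ->
  irreducible to E (tensv IndU W).
Proof.
move=> irrU irrW; have [U0 _ _] := irrU; have [W0 stW _] := irrW.
have irrU' := irreducible_ext0 irrU; have [U'0 stU' _] := irrU'.
have sU'Ind : (U' <= IndU)%VS.
  by apply/subvP => _ /memv_imgP[f fU ->]; rewrite lfunE; apply: ext0_induced.
split; last 1 first.
- move=> M sM stM; have [->|M0] := eqVneq M 0%VS; first by left.
  right.
  have ltM g F : F \in M -> perm_rep to (([ffun=> 1%g], g) : wr) F \in M.
    by move=> FM; apply: stM => //; apply: crested_diag.
  have [F' [F'M F'nz F'A0]] := exists_supported sM stM M0.
  have F'T : F' \in tensv U' W.
    have /tensvP[F'W F'Ind] := subvP sM F' F'M.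
    apply/tensvP; split=> // y.
    apply: (induced_supported partP invP A0P lA stU) => // x xA0.
    by have /ffunP/(_ y) := F'A0 x xA0; rewrite !ffunE.
  (* [M1] is stable under the pairs formed of a constant function and an
     element of T, which act factor by factor. *)
  pose M1 := (M :&: tensv U' W)%VS.
  have M10 : M1 != 0%VS.
    apply: contraNneq F'nz => M10; rewrite -memv0 -M10 memv_cap F'M.
    exact: F'T.
  have defM1 : M1 = tensv U' W.
    apply: (outer_tensor_irreducible irrU' irrW (capvSr _ _) M10).
      move=> c G _ /memv_capP[GM /tensvP[GW GU]]; rewrite memv_cap.
      rewrite {1}perm_rep_snd stM ?crested_diag //=.
      apply/tensvP; split=> z; first by rewrite xslice_snd stW ?inE.
      have -> // : yslice z (perm_rep (snd_action X toY) c G) =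
          yslice (toY z c) G.
      by apply/ffunP => x; rewrite ffunE perm_repE ffunE.
    move=> t v w tT /memv_capP[vwM /tensvP[vwW vwU]]; rewrite memv_cap.
    rewrite -{1}perm_rep_tensl ltM //=; apply/tensvP; split=> z.
      by rewrite xslice_tens perm_repE -xslice_tens.
    by rewrite yslice_tens -linearZ /= -yslice_tens stU'.
  have sU'M v w : v \in U' -> w \in W -> tens v w \in M.
    move=> vU wW; apply: (subvP (capvSl M (tensv U' W))).
    by rewrite -/M1 defM1 mem_tensv.
  apply/eqP; rewrite eqEsubv sM; apply: tensv_sub => v w.
  case/memv_sumP=> h hU -> wW.
  have -> : tens (\sum_(B in P) h B) w = \sum_(B in P) tens (h B) w.
    exact: (linear_sum (tensr w)).
  apply: memv_suml => B BP; have /memv_imgP[v' v'U ->] := hU B BP.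
  by rewrite lfunE -perm_rep_tensl ltM ?sU'M.
- apply: tensv_neq0 => //; apply: contraNneq U'0 => Ind0.
  by rewrite -subv0 -Ind0.
- exact: stable_fine.
Qed.

(** No nonzero vector of [W] is fixed by N, and R contains elements acting on
    the slices off A_0 by any given element of N; R-invariant functions thus
    vanish there. *)
Lemma invariants_fine :
  invariants to R (tensv IndU W) =
  tensv (linfun (@ext0 C X A0) @: invariants toX^? 'C[x0 | toX]%g U)
        (invariants toY 'C[y0 | toY]%g W).
Proof.
have KT g : g \in ('C[x0 | toX])%g -> g \in T.
  by move=> /astab1P gx; apply: (mem_part_norm partP invP A0P x0A0); rewrite gx.
apply/eqP; rewrite eqEsubv; apply/andP; split.
  apply/subvP => F FR; have [FW FInd] := invariant_slices FR.
  have [/tensvP[FW' _] fixF] := (invariantsP _ _ _ _).1 FR.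
  (* The element equal to 1 on A_0 and to [n] elsewhere fixes (x_0, y_0). *)
  have F0 x : x \notin A0 -> xslice x F = 0.
    move=> xA0; apply: kernel_fixed_eq0 => // n nN.
    have nR : (([ffun x => if x \in A0 then 1%g else n], 1%g) : wr) \in R.
      by rewrite mem_stab crested_kernel ?group1 //= ffunE x0A0 group1.
    have := fixF _ nR => /(congr1 (xslice x)).
    by rewrite xslice_wreath /= act1 ffunE (negPf xA0).
  apply/tensvP; split=> // y; have /invariantsP[yInd yfix] := FInd y.
  have yA0 x : x \notin A0 -> yslice y F x = 0.
    by move=> xA0; have /ffunP/(_ y) := F0 x xA0; rewrite !ffunE.
  have /memv_imgP[f fU defy] :=
    induced_supported partP invP A0P lA stU yInd yA0.
  rewrite defy; apply: memv_img; apply/invariantsP; split=> // g gK.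
  rewrite -[LHS]ext0K ext0_perm_rep ?KT // -[in RHS](ext0K f).
  by rewrite lfunE in defy; rewrite -defy yfix.
apply: tensv_sub => _ w /memv_imgP[f /invariantsP[fU fixf] ->].
move=> /invariantsP[wW fixw]; rewrite lfunE /=; apply/invariantsP; split.
  by apply: mem_tensv => //; apply: ext0_induced.
move=> u; rewrite mem_stab => /and3P[uE uK uH].
have uV : u.2^-1%g \in T by rewrite groupV KT.
rewrite (perm_rep_tens_part (x := x0) _ uE A0P) // => [|z].
  by rewrite -ext0_perm_rep ?KT // fixf ?fixw.
by rewrite (astabs_act _ uV); apply: contraNT => /ext0_out->.
Qed.

(** Off A_0 the coefficient vanishes because g A_0 and A_0 are then disjoint
    supports; on A_0 the element g stabilizes A_0. *)
Lemma spherical_fine (I J : finType) (f : I -> fspace C {x | x \in A0})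
    (w : J -> fspace C Y) theta psi :
  spherical_coefficients toX^? T (exist (fun x => x \in A0) x0 x0A0) f theta ->
  spherical_coefficients toY [set: fT] y0 w psi ->
  spherical_coefficients to E (x0, y0)
    (fun ij : I * J => tens (ext0 (f ij.1)) (w ij.2))
    (fun ij ij' => tens (ext0 (theta ij.1 ij'.1)) (psi ij.2 ij'.2)).
Proof.
move=> sphth sphpsi [i j] [i' j'] u uE.
have xA : lact toX u.2 x0 \in toX^*%act A0 u.2^-1%g by apply: mem_setact.
have supp z : ext0 (f i') z != 0 -> toX z u.2^-1%g \in toX^*%act A0 u.2^-1%g.
  by move=> fz; apply: mem_setact; apply: contraNT fz => /ext0_out->.
rewrite (perm_rep_tens_part _ uE (setact_part invP _ A0P) supp xA).
rewrite inner_tens lact_wreath ffunE /= sphpsi ?inE //; congr (_ * _).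
have [gA0 | gA0] := boolP (lact toX u.2 x0 \in A0).
  have uVT : u.2^-1%g \in T by apply: (mem_part_norm partP invP A0P x0A0 gA0).
  have uT : u.2 \in T by rewrite -groupV.
  by rewrite -ext0_perm_rep // inner_ext0 -sphth // -ext0_val val_stab_subact.
rewrite ext0_out // /inner big1 // => x _; rewrite perm_repE.
have [xA0|/ext0_out->] := boolP (x \in A0); last by rewrite mul0r.
rewrite [ext0 (f i') _]ext0_out ?conjC0 ?mulr0 //.
apply: contra gA0 => xuA0; have uT := mem_part_norm partP invP A0P xA0 xuA0.
by rewrite (astabs_act _ (groupVr uT)).
Qed.

End Fine.

End Crested.

Theorem theorem4p15
  (C : numClosedFieldType) (gT fT : finGroupType) (X Y : finType)
  (toX : {action gT &-> X}) (toY : {action fT &-> Y})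
  (x0 : X) (y0 : Y)
  (transX : [transitive [set: gT], on [set: X] | toX])
  (transY : [transitive [set: fT], on [set: Y] | toY])
  (P : {set {set X}}) (Q : {set {set Y}})
  (partP : partition P [set: X]) (partQ : partition Q [set: Y])
  (invP : [acts [set: gT], on P | toX^*])
  (invQ : [acts [set: fT], on Q | toY^*])
  (transN : forall B, B \in Q ->
     [transitive parts_kernel toY Q, on B | toY])
  (A0 : {set X}) (A0P : A0 \in P) (x0A0 : x0 \in A0)
  (l : {set X} -> gT)
  (lA : forall A, A \in P -> [set lact toX (l A) x | x in A0] = A)
  (lA0 : l A0 = 1%g)
  (Omega : finType) (a : Omega -> nat) (V : Omega -> {vspace fspace C X})
  (decX : decomposition toX [set: gT] fullv [set: Omega] a V)
  (Delta : finType) (b : Delta -> nat) (W : Delta -> {vspace fspace C Y})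
  (decY : decomposition toY [set: fT] fullv [set: Delta] b W)
  (Gamma : finType) (c : Gamma -> nat)
  (U : Gamma -> {vspace fspace C {x | x \in A0}})
  (decA0 : decomposition toX^? 'N(A0 | toX)%g fullv [set: Gamma] c U)
  (Delta0 : {set Delta})
  (decQ : decomposition toY [set: fT] (const_on_parts C Q) Delta0 b W)
  (v : forall omega, 'I_(a omega) -> fspace C X)
  (onbv : forall omega,
     orthonormal_basis (v omega) (invariants toX 'C[x0 | toX]%g (V omega)))
  (w : forall delta, 'I_(b delta) -> fspace C Y)
  (onbw : forall delta,
     orthonormal_basis (w delta) (invariants toY 'C[y0 | toY]%g (W delta)))
  (u : forall gamma, 'I_(c gamma) -> fspace C {x | x \in A0})
  (onbu : forall gamma,
     orthonormal_basis (u gamma) (invariants toX^? 'C[x0 | toX]%g (U gamma)))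
  (phi : forall omega, 'I_(a omega) -> 'I_(a omega) -> fspace C X)
  (sphphi : forall omega,
     spherical_coefficients toX [set: gT] x0 (v omega) (phi omega))
  (psi : forall delta, 'I_(b delta) -> 'I_(b delta) -> fspace C Y)
  (sphpsi : forall delta,
     spherical_coefficients toY [set: fT] y0 (w delta) (psi delta))
  (theta : forall gamma,
     'I_(c gamma) -> 'I_(c gamma) -> fspace C {x | x \in A0})
  (sphtheta : forall gamma,
     spherical_coefficients toX^? 'N(A0 | toX)%g
       (exist (fun x => x \in A0) x0 x0A0) (u gamma) (theta gamma)) :
  let to := wreath_action toX toY in
  let E := crested toX toY P Q in
  let R := ('C_E[(x0, y0) | to])%g in
  (forall omega delta, delta \in Delta0 ->
     let e (ij : 'I_(a omega) * 'I_(b delta)) :=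
       tens (v omega ij.1) (w delta ij.2) in
     [/\ irreducible to E (tensv (V omega) (W delta)),
         orthonormal_basis e (invariants to R (tensv (V omega) (W delta))) &
         spherical_coefficients to E (x0, y0) e
           (fun ij ij' =>
              tens (phi omega ij.1 ij'.1) (psi delta ij.2 ij'.2))]) /\
  (forall gamma delta, delta \notin Delta0 ->
     let IndU := induced toX P l (U gamma) in
     let e (hj : 'I_(c gamma) * 'I_(b delta)) :=
       tens (ext0 (u gamma hj.1)) (w delta hj.2) in
     [/\ irreducible to E (tensv IndU (W delta)),
         orthonormal_basis e (invariants to R (tensv IndU (W delta))) &
         spherical_coefficients to E (x0, y0) e
           (fun hj hj' =>
              tens (ext0 (theta gamma hj.1 hj'.1)) (psi delta hj.2 hj'.2))]).
Proof.
have [irrV _ _] := decX; have [irrW _ _] := decY; have [irrU _ _] := decA0.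
have inQ delta := irreducible_decomposition_const partQ delta transN decY decQ.
split=> [omega delta D0 e | gamma delta D0 IndU e].
  have WQ : (W delta <= const_on_parts C Q)%VS by rewrite inQ.
  have wW j : w delta j \in W delta.
    have [_ defW] := onbw delta.
    have : w delta j \in <<codom (w delta)>>%VS by rewrite memv_span ?codom_f.
    by rewrite defW => /invariantsP[].
  split; first exact: irreducible_coarse.
    by rewrite invariants_coarse //; apply: orthonormal_tens.
  exact: (spherical_coarse partQ invQ WQ wW (sphphi omega) (sphpsi delta)).
have [_ stU _] := irrU gamma.
have WQ0 : (W delta :&: const_on_parts C Q)%VS = 0%VS.
  apply: irreducible_cap_eq0 (irrW delta) _ _; last by rewrite inQ.
  exact: const_on_parts_stable.
split.
- exact: (irreducible_fine partP invP transN A0P x0A0 lA stU WQ0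
    (irrU gamma) (irrW delta)).
- rewrite /IndU (invariants_fine partP invP transN y0 A0P x0A0 lA stU WQ0).
  exact: (orthonormal_tens (orthonormal_ext0 (onbu gamma)) (onbw delta)).
- exact: (spherical_fine partP invP A0P (sphtheta gamma) (sphpsi delta)).
Qed.
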